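(* Let $p_1,\dots,p_l$ be pairwise relatively prime integers with $1<p_1<p_2<\dots<p_l$, and let $\tau:\mathbb{Z}_{\ge0}\to\mathbb{Z}$ be the associated sequence. The generating function $F(x)=\sum_n\tau(n)x^n$ is given by $$F(x)=\frac{G(x)}{(1-x^{p_1})(1-x^{p_2})\cdots(1-x^{p_l})},$$ where $G(x)$ is a polynomial in $x$ with degree less than or equal to $p_1+p_2+\dots+p_l-1$. Furthermore, if $|e_0|\neq1$, then the degree of $G(x)$ is exactly $p_1+p_2+\dots+p_l-1$.
   Context: $(e_0,p_1',\dots,p_l')$ are the unique integers with $1\le p_i'\le p_i-1$ for $i=1,\dots,l$ and $e_0p_1\cdots p_l+\sum_{i=1}^l p_i'\prod_{j\ne i}p_j=-1$. The sequence $\tau$ is defined by $\tau(0)=0$ and $$\tau(n+1)=\tau(n)+1+|e_0|n-\sum_{i=1}^l\left\lceil\frac{np_i'}{p_i}\right\rceil .$$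
   Formalization: The number l of integers is assumed to be at least 3; for l ≤ 2 the claim is always false, since τ grows quadratically and F has a pole of order 3 at x = 1, while the denominator vanishes there only to order l. *)

(* Defs.v *)
From HB Require Import structures.
From mathcomp Require Import all_boot all_order all_algebra.

Set Implicit Arguments.
Unset Strict Implicit.
Unset Printing Implicit Defensive.

Import Order.TTheory GRing.Theory Num.Theory.
Local Open Scope ring_scope.

(* A formal power series sum_n a_n x^n is its coefficient sequence; equality
   of series is pointwise equality [=1]. *)
Definition fps (R : Type) := nat -> R.

Definition fps_of_poly (R : nzRingType) (q : {poly R}) : fps R :=
  fun n => q`_n.

Definition fps_mul (R : nzRingType) (a b : fps R) : fps R :=
  fun n => \sum_(i < n.+1) a i * b (n - i)%N.

(* First n coefficients of a / b, by the usual recursion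
   c_m = (a_m - sum_(i < m) c_i b_(m - i)) / b_0.
   This is the quotient in R[[x]] as soon as b_0 is a unit of R:
   see fps_divK and fps_div_unique. *)
Fixpoint fps_div_prefix (R : comUnitRingType) (a b : fps R) (n : nat) : seq R :=
  if n is m.+1 then
    let s := fps_div_prefix a b m in
    rcons s ((a m - \sum_(i < m) s`_i * b (m - i)%N) / b 0%N)
  else [::].

Definition fps_div (R : comUnitRingType) (a b : fps R) : fps R :=
  fun n => (fps_div_prefix a b n.+1)`_n.

Lemma size_fps_div_prefix (R : comUnitRingType) (a b : fps R) n :
  size (fps_div_prefix a b n) = n.
Proof. by elim: n => //= n IH; rewrite size_rcons IH. Qed.

Lemma nth_fps_div_prefix (R : comUnitRingType) (a b : fps R) n i :
  (i < n)%N -> (fps_div_prefix a b n)`_i = fps_div a b i.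
Proof.
elim: n => // n IH; rewrite ltnS leq_eqVlt => /orP[/eqP-> //|lin].
by rewrite [LHS]/= nth_rcons size_fps_div_prefix lin IH.
Qed.

Lemma fps_divE (R : comUnitRingType) (a b : fps R) n :
  fps_div a b n = (a n - \sum_(i < n) fps_div a b i * b (n - i)%N) / b 0%N.
Proof.
rewrite {1}/fps_div /= nth_rcons size_fps_div_prefix ltnn eqxx.
by under eq_bigr => i _ do rewrite nth_fps_div_prefix //.
Qed.

Lemma fps_divK (R : comUnitRingType) (a b : fps R) :
  b 0%N \is a GRing.unit -> fps_mul (fps_div a b) b =1 a.
Proof.
move=> ub n; rewrite /fps_mul big_ord_recr /= subnn (fps_divE a b n).
by rewrite divrK // addrC subrK.
Qed.

Lemma fps_div_unique (R : comUnitRingType) (a b c : fps R) :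
  b 0%N \is a GRing.unit -> fps_mul c b =1 a -> c =1 fps_div a b.
Proof.
move=> ub cb n; elim/ltn_ind: n => n IH; rewrite fps_divE -cb /fps_mul.
rewrite big_ord_recr /= subnn.
under [X in _ - X]eq_bigr => i _ do rewrite -IH //.
by rewrite addrAC subrr add0r mulrK.
Qed.

(* (e0, p'_1, ..., p'_l), uniquely determined by pairwise coprime p_i > 1. *)
Definition seifert_invariants (l : nat) (p : 'I_l -> nat)
    (e0 : int) (p' : 'I_l -> int) : Prop :=
  (forall i, 1 <= p' i <= (p i)%:Z - 1) /\
  e0 * \prod_(i < l) (p i)%:Z
    + \sum_(i < l) p' i * \prod_(j < l | j != i) (p j)%:Z = -1.

Fixpoint tau (l : nat) (p : 'I_l -> nat) (e0 : int) (p' : 'I_l -> int)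
    (n : nat) : int :=
  if n is m.+1 then
    tau p e0 p' m + 1 + `|e0| * m%:Z
      - \sum_(i < l) Num.ceil ((m%:Z * p' i)%:~R / (p i)%:R : rat)
  else 0.

(* Main.v *)
Require Import Defs.
From HB Require Import structures.
From mathcomp Require Import all_boot all_order all_algebra.
From mathcomp Require Import zify ring.

Set Implicit Arguments.
Unset Strict Implicit.
Unset Printing Implicit Defensive.

Import Order.TTheory GRing.Theory Num.Theory.
Local Open Scope ring_scope.

(* Extend tau to a sequence t on all integers, by running the recurrence
   backwards as well.  Let the polynomial ring act on two-sided sequences, with
   X the delay t(n) |-> t(n - 1).  Each summand f of the increment of tau (the
   affine one and the l ceilings) satisfies f(n) - f(n - p_i) = constant for
   some i.  Hence D = prod_i (1 - X^(p_i)) annihilates the indefinite sum of f: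
   one factor other than 1 - X^(p_i) undoes the summation, the factor
   1 - X^(p_i) makes the result constant, and a third factor kills the constant.
   So D annihilates t.  The coefficient of x^n in D F is the value (D t)(n) with
   the terms t(m), m < 0, omitted.  None is omitted for n >= sum_i p_i, and for
   n = sum_i p_i - 1 only the term in t(-1) = |e0| - 1 is. *)

Section DelayAction.
Variable R : comNzRingType.
Implicit Types (q : {poly R}) (f : int -> R).

Definition delay q f (n : int) : R := \sum_(k < size q) q`_k * f (n - k%:Z).

Lemma delay_widen m q f n :
  (size q <= m)%N -> delay q f n = \sum_(k < m) q`_k * f (n - k%:Z).
Proof.
move=> le_qm.
rewrite /delay (big_ord_widen m (fun k => q`_k * f (n - k%:Z))) //.
rewrite big_mkcond; apply: eq_bigr => k _; case: ltnP => // le_qk.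
by rewrite nth_default // mul0r.
Qed.

Lemma eq_delay q f g : f =1 g -> delay q f =1 delay q g.
Proof. by move=> fg n; apply: eq_bigr => k _; rewrite fg. Qed.

Lemma delay0 q n : delay q (fun=> 0) n = 0.
Proof. by apply: big1 => k _; rewrite mulr0. Qed.

Lemma delayB q f g n :
  delay q (fun m => f m - g m) n = delay q f n - delay q g n.
Proof. by rewrite /delay -sumrB; apply: eq_bigr => k _; rewrite mulrBr. Qed.

Lemma delay_sum (I : finType) q (f : I -> int -> R) n :
  delay q (fun m => \sum_i f i m) n = \sum_i delay q (f i) n.
Proof.
by rewrite /delay exchange_big; apply: eq_bigr => k _; rewrite mulr_sumr.
Qed.

(** Products of polynomials act by composition. All sums are padded to the common length
    [a + size q]. *)
Lemma delay_diffM a q f n :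
  delay ((1 - 'X^a) * q) f n = delay q (fun m => f m - f (m - a%:Z)) n.
Proof.
have le_q : (size ('X^a * q)%R <= a + size q)%N.
  by apply: leq_trans (size_polyMleq _ _) _; rewrite size_polyXn.
have le_s : (size ((1 - 'X^a) * q)%R <= a + size q)%N.
  rewrite mulrBl mul1r (leq_trans (size_polyD _ _)) // size_polyN geq_max.
  by rewrite leq_addl.
rewrite delayB (delay_widen _ _ le_s) (delay_widen f n (leq_addl a (size q))).
have -> : delay q (fun m => f (m - a%:Z)) n =
    \sum_(k < a + size q) ('X^a * q)`_k * f (n - k%:Z).
  rewrite big_split_ord /= [X in _ = X + _]big1 ?add0r => [|k _].
    apply: eq_bigr => k _; rewrite coefXnM ltnNge leq_addr addKn.
    by rewrite PoszD opprD addrA addrAC.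
  by rewrite coefXnM ltn_ord mul0r.
by rewrite -sumrB; apply: eq_bigr => k _; rewrite mulrBl mul1r coefB mulrBl.
Qed.

(** Normalised to vanish at 0; the sign at [Negz m], which is -(m + 1), makes the difference
    equation hold on both sides of 0. *)
Definition indef_sum f (n : int) : R :=
  match n with
  | Posz m => \sum_(k < m) f k%:Z
  | Negz m => - \sum_(k < m.+1) f (- k.+1%:Z)
  end.

Lemma indef_sumS f n : indef_sum f n - indef_sum f (n - 1) = f (n - 1).
Proof.
case: n => [[|n]|n].
- by rewrite (_ : 0%:Z - 1 = Negz 0) //= big_ord0 big_ord1 sub0r opprK.
- rewrite (_ : n.+1%:Z - 1 = n%:Z) /=; last by lia.
  by rewrite big_ord_recr /= addrAC subrr add0r.
- rewrite (_ : Negz n - 1 = Negz n.+1) /=; last by lia.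
  by rewrite [in X in _ - X]big_ord_recr /= opprK addrA addNr add0r.
Qed.

Lemma indef_sum_diff f a n :
  indef_sum f n - indef_sum f (n - a%:Z) = \sum_(k < a) f (n - k.+1%:Z).
Proof.
elim: a => [|a IH]; first by rewrite big_ord0 subr0 subrr.
rewrite big_ord_recr /= -IH.
have -> : n - a.+1%:Z = n - a%:Z - 1 by lia.
by rewrite -(indef_sumS f) addrA subrK.
Qed.

Lemma indef_sumN1 f : indef_sum f (- 1) = - f (- 1).
Proof. by rewrite /= big_ord1. Qed.

Lemma delay_indef_sum_eq0 l (p : 'I_l -> nat) (i : 'I_l) f c :
    (3 <= l)%N -> (forall n, f n - f (n - (p i)%:Z) = c) ->
  delay (\prod_(j < l) (1 - 'X^(p j))) (indef_sum f) =1 fun=> 0.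
Proof.
move=> l_ge3 fi n.
(* [3 <= l] leaves two indices besides [i]. *)
have /card_gt1P[j [k [+ + jk]]] : (1 < #|predC1 i|)%N.
  by rewrite cardC1 card_ord -ltnS prednK // (leq_trans _ l_ge3).
rewrite !inE => ji ki.
rewrite (bigD1 j) //= (bigD1 i) /=; last by rewrite eq_sym.
rewrite (bigD1 k) /=; last by rewrite eq_sym jk ki.
rewrite !delay_diffM; set q := \prod_(_ | _) _; rewrite -[RHS](delay0 q n).
(* Each of the [p j] differences of [f] over the distance [p i] equals [c]; the total is independent
   of [m], so the factor of index [k] kills it. *)
have sum_diff m : indef_sum f m - indef_sum f (m - (p j)%:Z)
    - (indef_sum f (m - (p i)%:Z) - indef_sum f (m - (p i)%:Z - (p j)%:Z))
    = \sum_(h < p j) c.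
  rewrite !indef_sum_diff -sumrB; apply: eq_bigr => h _.
  by rewrite -(fi (m - h.+1%:Z)) addrAC.
by apply: eq_delay => m; rewrite !sum_diff subrr.
Qed.

End DelayAction.

Lemma size_prod_1subXn (R : idomainType) (l : nat) (p : 'I_l -> nat) :
    (forall i, 0 < p i)%N ->
  size (\prod_(i < l) (1 - 'X^(p i)) : {poly R}) = (\sum_(i < l) p i).+1.
Proof.
move=> p_gt0.
have sz i : size (1 - 'X^(p i) : {poly R}) = (p i).+1.
  by rewrite -size_polyN opprB size_XnsubC.
rewrite size_prod => [|i _]; last by rewrite -size_poly_gt0 sz.
under eq_bigr => i _ do rewrite sz -addn1.
by rewrite big_split /= sum1_card subSn ?leq_addl // addnK.
Qed.

(** Passing from n - p to n adds the integer q to the quotient, and integers come out of the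
    ceiling. *)
Lemma ceil_div_diff (n q : int) (p : nat) : (0 < p)%N ->
  Num.ceil ((n * q)%:~R / p%:R : rat)
    - Num.ceil (((n - p%:Z) * q)%:~R / p%:R : rat) = q.
Proof.
move=> p_gt0.
have p_neq0 : p%:R != 0 :> rat by rewrite pnatr_eq0 -lt0n.
have -> : (n * q)%:~R / p%:R = ((n - p%:Z) * q)%:~R / p%:R + q%:~R :> rat.
  rewrite mulrBl intrB (intrM _ p%:Z) mulrBl.
  by rewrite [_%:~R * _ / _]mulrAC divff // mul1r subrK.
by rewrite ceilDrz ?intr_int // intrKceil addrAC subrr add0r.
Qed.

Lemma ceil_div_itvN10 (q : int) (p : nat) : (0 < p)%N -> 0 <= q < p%:Z ->
  Num.ceil ((- 1 * q)%:~R / p%:R : rat) = 0.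
Proof.
move=> p_gt0 /andP[q_ge0 q_lt].
have p_gt0' : 0 < p%:R :> rat by rewrite ltr0n.
apply: ceil_def; rewrite mulN1r sub0r !intrN mulNr ltrN2 oppr_le0.
rewrite divr_ge0 ?ler0z ?ler0n // ltr_pdivrMr // mul1r andbT.
by rewrite -[p%:R]/(p%:Z%:~R) ltr_int.
Qed.

Definition tau_incr (l : nat) (p : 'I_l -> nat) (e0 : int) (p' : 'I_l -> int)
    (n : int) : int :=
  1 + `|e0| * n - \sum_(i < l) Num.ceil ((n * p' i)%:~R / (p i)%:R : rat).

Lemma tau_indef_sum l (p : 'I_l -> nat) e0 (p' : 'I_l -> int) (n : nat) :
  tau p e0 p' n = indef_sum (tau_incr p e0 p') n%:Z.
Proof.
elim: n => [|n IH] /=; first by rewrite big_ord0.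
by rewrite big_ord_recr /= IH /tau_incr !addrA.
Qed.

(** Separates the summands, since each ceiling is annihilated through its own index [i]. *)
Lemma indef_sum_tau_incr l (p : 'I_l -> nat) e0 (p' : 'I_l -> int) :
  indef_sum (tau_incr p e0 p') =1 fun n =>
    indef_sum (fun m => 1 + `|e0| * m) n
    - \sum_(i < l)
        indef_sum (fun m => Num.ceil ((m * p' i)%:~R / (p i)%:R : rat)) n.
Proof.
case=> n /=; first by rewrite exchange_big /= -sumrB.
rewrite sumrN exchange_big /= -opprB opprK addrC -sumrB -sumrN.
by apply: eq_bigr => k _; rewrite opprB.
Qed.

Lemma delay_tau_eq0 l (p : 'I_l -> nat) e0 (p' : 'I_l -> int) :
    (3 <= l)%N -> (forall i, 0 < p i)%N ->
  delay (\prod_(i < l) (1 - 'X^(p i))) (indef_sum (tau_incr p e0 p'))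
    =1 fun=> 0.
Proof.
move=> l_ge3 p_gt0 n.
rewrite (eq_delay _ (indef_sum_tau_incr p e0 p')) delayB delay_sum.
(* The affine summand has constant differences over every distance, so any index serves. *)
pose i0 := Ordinal (leq_trans (isT : (0 < 3)%N) l_ge3).
rewrite (@delay_indef_sum_eq0 _ _ _ i0 _ (`|e0| * (p i0)%:Z)) //; last first.
  by move=> m; ring.
rewrite big1 ?subr0 // => i _.
rewrite (@delay_indef_sum_eq0 _ _ _ i _ (p' i)) // => m.
exact: ceil_div_diff.
Qed.

(** The right side is [delay q f n] without the terms at negative arguments. *)
Lemma fps_mul_poly (R : comNzRingType) (f : int -> R) (q : {poly R}) n :
  fps_mul (fun m => f m%:Z) (fps_of_poly q) n
    = \sum_(k < n.+1) q`_k * f (n%:Z - k%:Z).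
Proof.
rewrite /fps_mul (reindex_inj rev_ord_inj) /=; apply: eq_bigr => k _.
have le_kn : (k <= n)%N by rewrite -ltnS.
by rewrite subSS subKn // mulrC subzn.
Qed.

(* [size G] is the degree of G plus one (and 0 for G = 0), so the bounds on
   deg G by sum_i p_i - 1 are bounds on [size G] by sum_i p_i.
   For l <= 2 the series F has a pole of order 3 at x = 1, which the
   denominator cannot cancel; hence 3 <= l. *)
Theorem theorem1p14 (l : nat) (p : 'I_l -> nat) (e0 : int) (p' : 'I_l -> int)
    (l_ge3 : (3 <= l)%N)
    (p_gt1 : forall i : 'I_l, (1 < p i)%N)
    (p_incr : forall i j : 'I_l, (i < j)%N -> (p i < p j)%N)
    (p_coprime : forall i j : 'I_l, i != j -> coprime (p i) (p j))
    (e0p' : seifert_invariants p e0 p') :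
  exists G : {poly int},
    [/\ tau p e0 p' =1
          fps_div (fps_of_poly G)
                  (fps_of_poly (\prod_(i < l) (1 - 'X^(p i)))),
        (size G <= \sum_(i < l) p i)%N
      & `|e0| != 1 -> size G = (\sum_(i < l) p i)%N].
Proof.
have p_gt0 i : (0 < p i)%N by exact: ltnW.
set D := \prod_(i < l) _; set N := (\sum_(i < l) p i)%N.
have size_D : size D = N.+1 by exact: size_prod_1subXn.
pose t := indef_sum (tau_incr p e0 p').
have Dt n : delay D t n = 0 by exact: delay_tau_eq0.
pose g n : int := \sum_(k < n.+1) D`_k * t (n%:Z - k%:Z).
have g_eq0 n : (N <= n)%N -> g n = 0.
  by move=> le_Nn; rewrite -(Dt n%:Z) (@delay_widen _ n.+1) ?size_D.
(* The bounds on [p' i] make every ceiling at -1 vanish. *)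
have tN1 : t (- 1) = `|e0| - 1.
  rewrite /t indef_sumN1 /tau_incr big1 ?subr0 => [|i _]; first by ring.
  apply: ceil_div_itvN10 => //; have [/(_ i)] := e0p'; lia.
exists (\poly_(n < N) g n); split; last 1 first.
- move=> e0_neq1.
  have N_gt0 : (0 < N)%N.
    have i0 := Ordinal (leq_trans (isT : (0 < 3)%N) l_ge3).
    by rewrite /N (bigD1 i0) //= addn_gt0 p_gt0.
  apply: size_poly_eq.
  (* Of the N + 1 terms of (D t)(N - 1) = 0, the first N form g(N - 1). So the top coefficient of G
     is -D_N t(-1), where D_N is the leading coefficient of D. *)
  have := Dt N.-1%:Z; rewrite /delay size_D big_ord_recr /=.
  have -> : N.-1%:Z - N%:Z = -1 by lia.
  rewrite /g prednK // => /eqP; rewrite addr_eq0 => /eqP->.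
  rewrite oppr_eq0 mulf_neq0 ?tN1 ?subr_eq0 //.
  rewrite -[N]/(N.+1.-1) -size_D -lead_coefE lead_coef_eq0.
  by rewrite -size_poly_gt0 size_D.
- apply: fps_div_unique.
    (* The constant coefficient is D(0) = 1, as every [p i] is positive. *)
    rewrite /fps_of_poly -horner_coef0 horner_prod big1 ?unitr1 // => i _.
    by rewrite !hornerE expr0n -[p i == 0]negbK -lt0n p_gt0 subr0.
  move=> n; transitivity (g n).
    rewrite /g -fps_mul_poly; apply: eq_bigr => k _.
    by rewrite tau_indef_sum.
  by rewrite /fps_of_poly coef_poly; case: ltnP => // /g_eq0.
- exact: size_poly.
Qed.
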